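(* Let $\mathbf T_H$ be the interface Schur complement and $\mathbf D_H$ its block diagonal, as defined in the context. Then $\mathbf S_H=\mathbf D_H^{-1}\mathbf T_H$ is self-adjoint and positive definite in the inner product $$\langle \mathbf x,\mathbf y\rangle_{\mathbf D_H}=\mathbf x^T\mathbf D_H\mathbf y .$$ Equivalently, $\mathbf S_H$ is similar to the Euclidean symmetric positive definite matrix $$\widetilde{\mathbf S}_H=\mathbf D_H^{-1/2}\,\mathbf T_H\,\mathbf D_H^{-1/2}.$$
   Context: Let $\mathbf A$ be a real symmetric positive definite (SPD) matrix arising from a compatible discretization of a symmetric coercive elliptic Dirichlet boundary value problem on a domain decomposed into slabs of width $H$ separated by internal interfaces $\Gamma_1,\dots,\Gamma_{N_{\rm ds}}$ (compatible: the local discrete spaces and operators are restrictions of a single global discretization). The active degrees of freedom are partitioned into the interface set $J=J_1\cup\dots\cup J_{N_{\rm ds}}$ (disjoint union, $J_j$ corresponding to $\Gamma_j$) and the remaining slab-interior set $I$. The interface Schur complement is $$\mathbf T_H=\mathbf A_{JJ}-\mathbf A_{JI}\mathbf A_{II}^{-1}\mathbf A_{IJ},$$ with blocks $\mathbf T_{ij}=\mathbf T_H(J_i,J_j)$, and $$\mathbf D_H=\operatorname{diag}(\mathbf T_{11},\dots,\mathbf T_{N_{\rm ds},N_{\rm ds}})$$ is its block diagonal. $\mathbf D_H^{\pm1/2}$ denotes the SPD square root of $\mathbf D_H$ and its inverse. *)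

(* Defs.v *)
From mathcomp Require Import all_boot all_order all_algebra.
From mathcomp Require Import reals.

Set Implicit Arguments.
Unset Strict Implicit.
Unset Printing Implicit Defensive.

Import Order.TTheory GRing.Theory Num.Theory.
Local Open Scope ring_scope.

Definition spd (R : realType) (n : nat) (M : 'M[R]_n) : Prop :=
  M^T = M /\ forall x : 'cV[R]_n, x != 0 -> 0 < (x^T *m M *m x) 0 0.

Definition spd_sqrt (R : realType) (n : nat) (M B : 'M[R]_n) : Prop :=
  spd B /\ B *m B = M.

(* The bilinear form <x, y>_D = x^T D y; it is an inner product when D is SPD. *)
Definition ip (R : realType) (n : nat) (D : 'M[R]_n) (x y : 'cV[R]_n) : R :=
  (x^T *m D *m y) 0 0.

Definition ip_selfadjoint (R : realType) (n : nat) (D S : 'M[R]_n) : Prop :=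
  forall x y : 'cV[R]_n, ip D (S *m x) y = ip D x (S *m y).

Definition ip_posdef (R : realType) (n : nat) (D S : 'M[R]_n) : Prop :=
  forall x : 'cV[R]_n, x != 0 -> 0 < ip D (S *m x) x.

(* The submatrix A(X, Y), rows and columns taken in increasing index order. *)
Definition submx_on (R : realType) (n : nat) (A : 'M[R]_n) (X Y : {set 'I_n})
    : 'M[R]_(#|X|, #|Y|) :=
  mxsub (fun k : 'I_#|X| => enum_val k) (fun l : 'I_#|Y| => enum_val l) A.

(* The degrees of freedom are 'I_n and J j is the set J_j of those on the j-th
   interface. The unknowns of the interface set are numbered block after block
   (J_1, then J_2, ...), hence by 'I_(\sum_j #|J j|); within each block, and in
   the interior set, they keep the order of 'I_n. *)
Section Interface.
Variables (R : realType) (n N : nat) (A : 'M[R]_n) (J : 'I_N -> {set 'I_n}).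

Definition interior : {set 'I_n} := ~: \bigcup_j J j.

Definition A_JJ : 'M[R]_(\sum_j #|J j|) := \mxblock_(i, j) submx_on A (J i) (J j).
Definition A_JI : 'M[R]_(\sum_j #|J j|, #|interior|) :=
  \mxcol_i submx_on A (J i) interior.
Definition A_IJ : 'M[R]_(#|interior|, \sum_j #|J j|) :=
  \mxrow_j submx_on A interior (J j).
Definition A_II : 'M[R]_#|interior| := submx_on A interior interior.

Definition schur_compl : 'M[R]_(\sum_j #|J j|) :=
  A_JJ - A_JI *m invmx A_II *m A_IJ.

Definition schur_block (i j : 'I_N) : 'M[R]_(#|J i|, #|J j|) :=
  submxblock schur_compl i j.

Definition schur_diag : 'M[R]_(\sum_j #|J j|) := \mxdiag_j schur_block j j.

End Interface.

(* Main.v *)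
Require Import Defs.
From mathcomp Require Import all_boot all_order all_algebra.
From mathcomp Require Import reals spectral complex.

Import Order.TTheory GRing.Theory Num.Theory.
Local Open Scope ring_scope.

(** Everything about positivity is a congruence [V^T M V] with [V] injective.
    Write [K] and [L] for the 0-1 matrices that select the interface and the
    interior unknowns. Disjointness of the [J j] gives [K K^T = 1], [K L^T = 0]
    and [L L^T = 1]. Then [A_II = L A L^T] is SPD, and
    [T = Z^T A Z] where [Z = K^T - L^T A_II^-1 L A K^T] extends interface data
    to the interior by solving the interior equations ([schur_compl_congr]).
    Since [K Z = 1], [Z] is injective and [T] is SPD; hence so are its diagonal
    blocks, and their block diagonal [D].

    As [D] is symmetric and invertible, [<D^-1 T x, y>_D = x^T T y], which is
    symmetric and positive definite because [T] is. If [H] is the SPD square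
    root of [D], then [H (D^-1 T) H^-1 = H^-1 T H^-1], a congruence of [T].

    The square root needs an existence and uniqueness proof. A real symmetric
    matrix, seen over the complex numbers, is unitarily diagonalizable with
    real eigenvalues, so a real polynomial that vanishes at these eigenvalues
    vanishes at the matrix ([symmetric_annihilator]). If [q] interpolates the
    fourth root on the spectrum of an SPD matrix [M], then [C = q(M)] is real
    symmetric with [C^4 = M], and [C^2 = C^T 1 C] is an SPD square root of [M].
    For two SPD roots [B] and [B'] with difference [E],
    [B E + E B' = B^2 - B'^2 = 0], so [tr (E^T B E) = - tr (E B' E^T)]; both
    traces are nonnegative, hence zero, and [E = 0]. *)

(** * Positive definite matrices *)

(** The left inverse [W] expresses that [V] is injective. *)
Lemma spd_congr (R : realType) (m n : nat) (M : 'M[R]_n) (V : 'M[R]_(n, m))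
    (W : 'M[R]_(m, n)) :
  spd M -> W *m V = 1%:M -> spd (V^T *m M *m V).
Proof.
move=> [symM posM] WV; split; first by rewrite !trmx_mul trmxK symM mulmxA.
move=> x x0; have Vx0 : V *m x != 0.
  by apply: contraNneq x0 => Vx0; rewrite -[x]mul1mx -WV -mulmxA Vx0 mulmx0.
by have := posM _ Vx0; rewrite trmx_mul !mulmxA.
Qed.

Lemma spd_ge0 (R : realType) (n : nat) (M : 'M[R]_n) (x : 'cV[R]_n) :
  spd M -> 0 <= (x^T *m M *m x) 0 0.
Proof.
move=> [_ posM]; have [->|/posM/ltW //] := eqVneq x 0.
by rewrite mulmx0 mxE.
Qed.

Lemma spd1 (R : realType) (n : nat) : spd (1%:M : 'M[R]_n).
Proof.
split=> [|x /matrix0Pn[i [j]]]; first exact: trmx1.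
rewrite (ord1 j) => xi0; rewrite mulmx1 mxE (bigD1 i) //= mxE -expr2.
apply: ltr_wpDr; last by rewrite exprn_even_gt0.
by apply: sumr_ge0 => k _; rewrite mxE -expr2 sqr_ge0.
Qed.

Lemma spd_unitmx (R : realType) (n : nat) (M : 'M[R]_n) :
  spd M -> M \in unitmx.
Proof.
move=> [symM posM]; rewrite -row_free_unit -kermx_eq0; apply/negPn/negP.
move=> /rowV0Pn[v /sub_kermxP vM v0]; have := posM v^T.
by rewrite trmx_eq0 => /(_ v0); rewrite trmxK vM mul0mx mxE ltxx.
Qed.

Lemma spd_mxdiag (R : realType) (N : nat) (p : 'I_N -> nat)
    (B : forall i, 'M[R]_(p i)) :
  (forall i, spd (B i)) -> spd (\mxdiag_i B i).
Proof.
move=> spdB; split.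
  by rewrite tr_mxdiag; apply: eq_mxdiag => i; have [] := spdB i.
move=> x x0.
have -> : x^T *m \mxdiag_i B i *m x
        = \sum_i (submxcol x i)^T *m B i *m submxcol x i.
  rewrite -mulmxA -{1 2}[x]submxcolK mul_mxdiag_mxcol tr_mxcol mul_mxrow_mxcol.
  by apply: eq_bigr => i _; rewrite mulmxA.
have [i xi0] : exists i, submxcol x i != 0.
  apply/existsP; apply: contraNT x0 => /existsPn /= xi0.
  rewrite -[x]submxcolK -(mxcol0 _ (p_ := p)); apply/eqP/eq_mxcol => i.
  exact/eqP/negPn/xi0.
rewrite summxE (bigD1 i) //=; apply: ltr_wpDr; last by case: (spdB i) => _; apply.
by apply: sumr_ge0 => j _; apply: spd_ge0.
Qed.

(** * Self-adjointness for the inner product of [D] *)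

Lemma ip_invmxl (R : realType) (n : nat) (D T : 'M[R]_n) (x y : 'cV[R]_n) :
  spd D -> T^T = T -> ip D (invmx D *m T *m x) y = (x^T *m T *m y) 0 0.
Proof.
move=> spdD symT; have unitD := spd_unitmx _ _ _ spdD; case: spdD => symD _.
by rewrite /ip !trmx_mul trmx_inv symD symT !mulmxA mulmxKV.
Qed.

Lemma ip_invmxr (R : realType) (n : nat) (D T : 'M[R]_n) (x y : 'cV[R]_n) :
  D \in unitmx -> ip D x (invmx D *m T *m y) = (x^T *m T *m y) 0 0.
Proof. by move=> unitD; rewrite /ip !mulmxA mulmxK. Qed.

(** * The square root of a positive definite matrix *)

Lemma poly_interpolation (F : fieldType) (s : seq F) (f : F -> F) :
  exists q : {poly F}, {in s, forall a, q.[a] = f a}.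
Proof.
elim: s => [|b s [q qf]]; first by exists 0.
have [bs|bNs] := boolP (b \in s).
  by exists q => a; rewrite inE => /predU1P[->|]; apply: qf.
pose w := \prod_(a <- s) ('X - a%:P).
have wb0 : w.[b] != 0 by rewrite -rootE root_prod_XsubC.
exists (q + ((f b - q.[b]) / w.[b])%:P * w) => a.
rewrite inE !hornerE => /predU1P[->|sa]; first by rewrite divfK // addrC subrK.
have /rootP -> : root w a by rewrite root_prod_XsubC.
by rewrite mulr0 addr0 qf.
Qed.

(** The diagonalization takes place over the complex numbers; only the
    annihilation of [M] by polynomials is brought back to the reals. *)
Lemma symmetric_annihilator (R : rcfType) (n : nat) (M : 'M[R]_n.+1) :
  M^T = M ->
  exists s : seq R, {in s, forall a, eigenvalue M a} /\
    forall p : {poly R}, {in s, forall a, p.[a] = 0} -> horner_mx M p = 0.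
Proof.
move=> symM; pose MC := map_mx (real_complex R) M.
have hermM : MC \is hermsymmx.
  apply: realsym_hermsym.
    apply/is_hermitianmxP; rewrite expr0 scale1r.
    by apply/matrixP => i j; rewrite !mxE -[in LHS]symM mxE.
  by apply/mxOverP => i j; rewrite mxE complex_real.
have /orthomx_spectralP := hermitian_normalmx hermM.
set P := spectralmx MC; set sp := spectral_diag MC => MCE.
have unitP : P \in unitmx by apply: spectral_unit.
pose d := map_mx (@complex.Re R) sp.
have spE i : sp 0 i = real_complex R (d 0 i).
  rewrite mxE RRe_real //.
  by have /mxOverP := hermitian_spectral_diag_real hermM; apply.
exists [seq d 0 i | i : 'I_n.+1]; split.
  move=> _ /mapP[i _ ->]; rewrite -(eigenvalue_map (real_complex R)).
  apply/eigenvalueP; exists (row i P).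
    rewrite -/MC MCE -row_mul !mulmxA mulmxV // mul1mx.
    by rewrite row_mul row_diag_mx -scalemxAl -rowE spE.
  rewrite rowE mulmx_free_eq0 ?row_free_unit //.
  by apply/matrix0Pn; exists 0, i; rewrite mxE !eqxx oner_eq0.
move=> p p0; apply: (map_mx_inj (f := real_complex R)).
rewrite map_horner_mx -/MC MCE horner_mx_uconjC // horner_mx_diag.
rewrite [map_mx _ sp](_ : _ = 0) ?(linear0, mulmx0, mul0mx, map_mx0) //.
apply/matrixP => i j; rewrite (ord1 i) [LHS]mxE spE horner_map p0 /=.
  by rewrite rmorph0 mxE.
exact: image_f.
Qed.

Lemma horner_mx_sym (R : comNzRingType) (n : nat) (M : 'M[R]_n.+1)
    (p : {poly R}) :
  M^T = M -> (horner_mx M p)^T = horner_mx M p.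
Proof.
move=> symM; elim/poly_ind: p => [|p c IH]; first by rewrite rmorph0 trmx0.
rewrite rmorphD rmorphM /= horner_mx_X horner_mx_C linearD /= tr_scalar_mx.
congr (_ + _); rewrite trmx_mul symM IH.
by have /(congr1 (horner_mx M)) := mulrC 'X p; rewrite !rmorphM /= horner_mx_X.
Qed.

Lemma spd_eigenvalue_gt0 (R : realType) (n : nat) (M : 'M[R]_n) (a : R) :
  spd M -> eigenvalue M a -> 0 < a.
Proof.
move=> [_ posM] /eigenvalueP[v vM v0].
have vT0 : v^T != 0 by rewrite trmx_eq0.
have := posM _ vT0; have [_ /(_ _ vT0)] := spd1 R n.
rewrite trmxK mulmx1 vM -scalemxAl [X in _ -> 0 < X -> _]mxE => v_gt0.
by rewrite pmulr_lgt0.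
Qed.

(** Going through a symmetric fourth root [C] makes the positivity of the square
    root [C *m C] a congruence of the identity matrix, so the eigenvalues of the
    square root need not be studied. *)
Lemma spd_sqrt_exists (R : realType) (n : nat) (M : 'M[R]_n) :
  spd M -> exists B : 'M[R]_n, spd_sqrt M B.
Proof.
case: n M => [|n] M spdM.
  by exists M; split; rewrite // [M]thinmx0 mulmx0.
have unitM := spd_unitmx _ _ _ spdM; have [symM _] := spdM.
have [s [s_eig s_ann]] := symmetric_annihilator _ _ _ symM.
have [q qE] := poly_interpolation _ s (fun a => Num.sqrt (Num.sqrt a)).
pose C := horner_mx M q.
have symC : C^T = C by apply: horner_mx_sym.
have C4 : C *m C *m (C *m C) = M.
  have : horner_mx M (q ^+ 4 - 'X) = 0.
    apply: s_ann => a sa; rewrite !hornerE qE // (exprM _ 2 2).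
    have a_gt0 := spd_eigenvalue_gt0 _ _ _ _ spdM (s_eig a sa).
    by rewrite !sqr_sqrtr ?sqrtr_ge0 ?subrr // ltW.
  rewrite rmorphB rmorphXn /= horner_mx_X => /eqP.
  by rewrite subr_eq0 => /eqP <-; rewrite (exprM _ 2 2) !expr2.
exists (C *m C); split=> //.
(* [invmx M *m (C *m C *m C)] is a left inverse of [C], as [C ^+ 4 = M]. *)
have := spd_congr _ _ _ _ C (invmx M *m (C *m C *m C)) (spd1 R n.+1).
rewrite symC mulmx1; apply.
by rewrite -(mulVmx unitM) -{3}C4 !mulmxA.
Qed.

(** Transfers the positivity of [B] on vectors to positivity of the trace form on
    matrices, which the uniqueness of the square root relies on. *)
Lemma mxtrace_congr (R : comNzRingType) (m n : nat) (B : 'M[R]_n)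
    (E : 'M[R]_(n, m)) :
  \tr (E^T *m B *m E) = \sum_j ((col j E)^T *m B *m col j E) 0 0.
Proof.
apply: eq_bigr => j _; rewrite tr_col -row_mul [LHS]mxE [RHS]mxE.
by apply: eq_bigr => k _; rewrite 2!mxE [in RHS]mxE [col _ _ _ _]mxE.
Qed.

Lemma spd_mxtrace_ge0 (R : realType) (m n : nat) (B : 'M[R]_n)
    (E : 'M[R]_(n, m)) :
  spd B -> 0 <= \tr (E^T *m B *m E).
Proof.
by move=> spdB; rewrite mxtrace_congr; apply: sumr_ge0 => j _; apply: spd_ge0.
Qed.

Lemma spd_mxtrace_eq0 (R : realType) (m n : nat) (B : 'M[R]_n)
    (E : 'M[R]_(n, m)) :
  spd B -> \tr (E^T *m B *m E) = 0 -> E = 0.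
Proof.
move=> spdB; rewrite mxtrace_congr => /psumr_eq0P tr0.
apply/matrixP => i j; rewrite [RHS]mxE; apply/eqP; apply: contraTT isT => Eij0.
have /spdB.2 : col j E != 0.
  by apply: contraNneq Eij0 => /colP/(_ i); rewrite !mxE => ->.
by rewrite tr0 ?ltxx // => k _; apply: spd_ge0.
Qed.

(** The difference of the roots solves a homogeneous Sylvester equation with
    positive definite coefficients, so it is zero. *)
Lemma spd_sqrt_inj (R : realType) (n : nat) (M B B' : 'M[R]_n) :
  spd_sqrt M B -> spd_sqrt M B' -> B = B'.
Proof.
move=> [spdB BM] [spdB' B'M]; pose E := B - B'.
have EE : B *m E = - (E *m B').
  by rewrite mulmxBr mulmxBl BM B'M opprB.
apply: subr0_eq; apply: (spd_mxtrace_eq0 _ _ _ B) => //; rewrite -/E.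
have ge0 := spd_mxtrace_ge0 _ _ _ B E spdB.
have := spd_mxtrace_ge0 _ _ _ B' E^T spdB'.
have -> : \tr (E^T^T *m B' *m E^T) = - \tr (E^T *m B *m E).
  by rewrite trmxK mxtrace_mulC -[E^T *m B *m E]mulmxA EE mulmxN linearN opprK.
by rewrite oppr_ge0 => le0; apply/eqP; rewrite eq_le le0.
Qed.

(** * The interface Schur complement *)

(** Restriction to the unknowns in [X] as a 0-1 matrix: submatrices of [A] become
    products, and disjointness becomes orthogonality. *)
Definition selmx (R : realType) (n : nat) (X : {set 'I_n}) : 'M[R]_(#|X|, n) :=
  rowsub (fun k : 'I_#|X| => enum_val k) 1%:M.

Lemma submx_onE (R : realType) (n : nat) (A : 'M[R]_n) (X Y : {set 'I_n}) :
  submx_on A X Y = selmx R n X *m A *m (selmx R n Y)^T.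
Proof.
rewrite /selmx -rowsubE trmx_mxsub trmx1 mulmx_colsub mulmx1.
by apply/matrixP => i j; rewrite !mxE.
Qed.

Lemma selmx_mul_tr (R : realType) (n : nat) (X : {set 'I_n}) :
  selmx R n X *m (selmx R n X)^T = 1%:M.
Proof.
have := submx_onE R n 1%:M X X; rewrite mulmx1 => <-; apply/matrixP => i j.
by rewrite !mxE (inj_eq enum_val_inj).
Qed.

Lemma selmx_mul_tr_disjoint (R : realType) (n : nat) (X Y : {set 'I_n}) :
  [disjoint X & Y] -> selmx R n X *m (selmx R n Y)^T = 0.
Proof.
move=> disXY; have := submx_onE R n 1%:M X Y; rewrite mulmx1 => <-.
apply/matrixP => i j.
rewrite !mxE; case: eqP => // eij; have := disjointFr disXY (enum_valP i).
by rewrite eij enum_valP.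
Qed.

Section SchurComplement.
Variables (R : realType) (n N : nat) (A : 'M[R]_n) (J : 'I_N -> {set 'I_n}).

Definition interface_sel : 'M[R]_(\sum_j #|J j|, n) :=
  \mxcol_j selmx R n (J j).
Definition interior_sel : 'M[R]_(#|interior J|, n) := selmx R n (interior J).

Local Notation K := interface_sel.
Local Notation L := interior_sel.

Lemma A_IIE : A_II A J = L *m A *m L^T.
Proof. exact: submx_onE. Qed.

Lemma A_JIE : A_JI A J = K *m A *m L^T.
Proof. by rewrite !mxcol_mul; apply: eq_mxcol => i; apply: submx_onE. Qed.

Lemma A_IJE : A_IJ A J = L *m A *m K^T.
Proof. by rewrite tr_mxcol mul_mxrow; apply: eq_mxrow => i; apply: submx_onE. Qed.

Lemma A_JJE : A_JJ A J = K *m A *m K^T.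
Proof.
rewrite mxcol_mul tr_mxcol mul_mxcol_mxrow.
by apply: eq_mxblock => i j; apply: submx_onE.
Qed.

(** Interface data are extended to the interior by solving the interior
    equations with zero right-hand side. *)
Definition harmonic_ext : 'M[R]_(n, \sum_j #|J j|) :=
  K^T - L^T *m invmx (A_II A J) *m L *m A *m K^T.

Lemma interior_sel_mul_tr : L *m L^T = 1%:M.
Proof. exact: selmx_mul_tr. Qed.

Lemma interface_interior_mul_tr : K *m L^T = 0.
Proof.
rewrite mxcol_mul -(mxcol0 _ (p_ := fun j => #|J j|)); apply: eq_mxcol => j.
apply: selmx_mul_tr_disjoint; rewrite -setI_eq0 -subset0; apply/subsetP => i.
rewrite !inE => /andP[iJ /negP[]]; apply/bigcupP; by exists j.
Qed.

Hypothesis disjJ : forall i j : 'I_N, i != j -> [disjoint J i & J j].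

Lemma interface_sel_mul_tr : K *m K^T = 1%:M.
Proof.
rewrite tr_mxcol mul_mxcol_mxrow -mxdiagZ; apply: eq_mxblock => i j.
have [<-|ij] := eqVneq i j; first by rewrite conform_mx_id selmx_mul_tr.
exact/selmx_mul_tr_disjoint/disjJ.
Qed.

Lemma interface_harmonic_ext : K *m harmonic_ext = 1%:M.
Proof.
rewrite mulmxBr interface_sel_mul_tr !mulmxA interface_interior_mul_tr.
by rewrite !mul0mx subr0.
Qed.

Hypothesis spdA : spd A.

Lemma A_II_spd : spd (A_II A J).
Proof.
rewrite A_IIE -{1}[L]trmxK.
exact: spd_congr spdA interior_sel_mul_tr.
Qed.

(** The Schur complement is the energy of the harmonic extension; the terms of
    [Z^T A Z] that involve the interior part of [Z] vanish because [A Z] is zero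
    on the interior. *)
Lemma schur_compl_congr :
  schur_compl A J = harmonic_ext^T *m A *m harmonic_ext.
Proof.
have [symA _] := spdA; have [symII _] := A_II_spd.
have unitII := spd_unitmx _ _ _ A_II_spd.
have LAZ : L *m A *m harmonic_ext = 0.
  by rewrite mulmxBr !mulmxA -A_IIE mulmxV // mul1mx subrr.
have KAZ : K *m A *m harmonic_ext = schur_compl A J.
  by rewrite mulmxBr /schur_compl A_JJE A_JIE A_IJE !mulmxA.
have -> : harmonic_ext^T = K - K *m A *m L^T *m invmx (A_II A J) *m L.
  by rewrite linearB /= !trmx_mul !trmxK trmx_inv symII symA !mulmxA.
by rewrite -KAZ !mulmxBl -!mulmxA [L *m (A *m _)]mulmxA LAZ !mulmx0 subr0.
Qed.

Lemma schur_compl_spd : spd (schur_compl A J).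
Proof.
rewrite schur_compl_congr.
exact: spd_congr spdA interface_harmonic_ext.
Qed.

Lemma schur_block_spd (j : 'I_N) : spd (schur_block A J j j).
Proof.
pose E := submxrow (1%:M : 'M[R]_(\sum_j #|J j|)) j.
have EtE : E^T = submxcol 1%:M j by rewrite tr_submxrow trmx1.
have -> : schur_block A J j j = E^T *m schur_compl A J *m E.
  by rewrite EtE submxcol_mul mul1mx mul_submxrow mulmx1 -submxblockEv.
apply: (spd_congr _ _ _ _ _ E^T) schur_compl_spd _.
by rewrite EtE mul_submxrow mulmx1 -submxblockEv -mxdiagZ submxblock_diag.
Qed.

Lemma schur_diag_spd : spd (schur_diag A J).
Proof. exact/spd_mxdiag/schur_block_spd. Qed.

End SchurComplement.

(** * The block-Jacobi preconditioned Schur complement *)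

Theorem proposition4p1 (R : realType) (n N : nat) (A : 'M[R]_n)
    (J : 'I_N -> {set 'I_n})
    (spdA : spd A)
    (disjJ : forall i j : 'I_N, i != j -> [disjoint J i & J j]) :
  let T := schur_compl A J in
  let D := schur_diag A J in
  let S := invmx D *m T in
  [/\ spd D,
      ip_selfadjoint D S,
      ip_posdef D S
    & exists Dhalf : 'M[R]_(\sum_j #|J j|),
        let St := invmx Dhalf *m T *m invmx Dhalf in
        [/\ unique (spd_sqrt D) Dhalf,
            spd St
          & S ~_{in unitmx} St]].
Proof.
move=> T D S.
have spdT : spd T by apply: schur_compl_spd.
have spdD : spd D by apply: schur_diag_spd.
have [symT posT] := spdT; have unitD := spd_unitmx _ _ _ spdD.
split=> //.
- by move=> x y; rewrite ip_invmxl // ip_invmxr.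
- by move=> x x0; rewrite ip_invmxl //; apply: posT.
have [H sqrtH] := spd_sqrt_exists _ _ _ spdD.
have [spdH HD] := sqrtH; have unitH := spd_unitmx _ _ _ spdH.
exists H; split.
- by split=> // H'; apply: spd_sqrt_inj.
- have := spd_congr _ _ _ _ (invmx H) H spdT (mulmxV unitH).
  by rewrite trmx_inv spdH.1.
exists H => //; apply/simmxP => //; rewrite mulmxKV //.
have -> : S = invmx H *m invmx H *m T.
  rewrite /S; congr (_ *m T); apply: (can_inj (mulKmx unitD)).
  by rewrite mulmxV // -HD mulmxA mulmxK // mulmxV.
by rewrite !mulmxA mulmxV // mul1mx.
Qed.
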